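(* Let $X$ be a non-negative continuous random variable with density $f$, distribution function $F$ and finite mean, and let $X_1,X_2$ be two independent random variables each having distribution function $F$. For $t>0$ with $F(t)>0$ define $$H_t(X)=-\frac{1}{2F^2(t)}\int_0^t F^2(x)\,dx .$$ Then $$H_t(X)=-\frac12\,E\big(t-\max(X_1,X_2)\,\big|\,\max(X_1,X_2)\le t\big);$$ that is, $-2H_t(X)$ is the mean past life function at $t$ of a parallel system of two independent identical components with lifetimes $X_1,X_2$.
   Context: $H_t(X)$ is the dynamic cumulative extropy of $X$. The mean past life function of a non-negative random variable $Z$ is $r(t)=E(t-Z\mid Z\le t)$. The lifetime of a parallel system of two components is the maximum of their lifetimes. $F^2(t)$ means $(F(t))^2$. *)

(* Defs.v *)
From HB Require Import structures.
From mathcomp Require Import all_boot all_order all_algebra.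
From mathcomp Require Import all_classical all_reals all_analysis.
Import Order.TTheory GRing.Theory Num.Theory.
Import numFieldNormedType.Exports.

Set Implicit Arguments.
Unset Strict Implicit.
Unset Printing Implicit Defensive.

Local Open Scope classical_set_scope.
Local Open Scope ring_scope.

Definition has_density (d : measure_display) (T : measurableType d)
    (R : realType) (P : probability T R) (X : {RV P >-> R}) (f : R -> R) : Prop :=
  [/\ measurable_fun [set: R] f,
      (forall x, 0 <= f x) &
      (forall A : set R, measurable A ->
         distribution P X A = \int[lebesgue_measure]_(x in A) (f x)%:E)%E].

Definition independent_RV2 (d : measure_display) (T : measurableType d)
    (R : realType) (P : probability T R) (X Y : {RV P >-> R}) : Prop :=
  forall A B : set R, measurable A -> measurable B ->
    (P (X @^-1` A `&` Y @^-1` B) = P (X @^-1` A) * P (Y @^-1` B))%E.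

(* [cdf X x] is an extended real in [0, 1], so [fine] loses nothing. *)
Definition distribution_function (d : measure_display) (T : measurableType d)
    (R : realType) (P : probability T R) (X : {RV P >-> R}) (x : R) : R :=
  fine (cdf X x).

(* The integral is a real-valued Lebesgue integral; its integrand is measurable
   with values in [0, 1], so it is finite. *)
Definition dynamic_cumulative_extropy (d : measure_display)
    (T : measurableType d) (R : realType) (P : probability T R)
    (X : {RV P >-> R}) (t : R) : R :=
  let F := distribution_function X in
  - (1 / (2 * F t ^+ 2)) *
    \int[lebesgue_measure]_(x in `[0, t]) (F x ^+ 2).

(* Elementary conditional expectation E(Z | A) = E(Z 1_A) / P(A); it is the
   intended notion only when P(A) > 0. *)
Definition cond_expectation (d : measure_display) (T : measurableType d)
    (R : realType) (P : probability T R) (Z : T -> R) (A : set T) : \bar R :=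
  ('E_P[(fun w => Z w * \1_A w)%R] * ((fine (P A))^-1)%:E)%E.

Definition mean_past_life (d : measure_display) (T : measurableType d)
    (R : realType) (P : probability T R) (Z : T -> R) (t : R) : \bar R :=
  cond_expectation P (fun w => t - Z w) [set w | Z w <= t].

Definition parallel_lifetime (T : Type) (R : realType) (Y1 Y2 : T -> R) : T -> R :=
  fun w => Num.max (Y1 w) (Y2 w).

(* Main.v *)
Require Import Defs.
From HB Require Import structures.
From mathcomp Require Import all_boot all_order all_algebra.
From mathcomp Require Import all_classical all_reals all_analysis measurable_realfun.
From mathcomp Require Import ring.
Import Order.TTheory GRing.Theory Num.Theory.
Import numFieldNormedType.Exports.

Local Open Scope classical_set_scope.
Local Open Scope ring_scope.

(* By independence M = max(X1, X2) has distribution function F^2, and Tonelli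
   gives E((t - M) 1_{M <= t}) = \int_0^t P(M <= x) dx; dividing by
   P(M <= t) = F(t)^2 yields both identities. The density is used only to see
   that M has no atom at 0, so that F(0) = 0; as only the distribution of X1 and
   X2 is given, this is how M >= 0 almost surely is obtained. *)

Lemma measurable_sublevel (d : measure_display) (T : measurableType d)
    (R : realType) (Z : T -> R) (x : R) :
  measurable_fun [set: T] Z -> measurable [set w | Z w <= x].
Proof.
move=> mZ; have := measurable_fun_ler mZ (@measurable_cst _ _ _ _ setT x).
by move=> /(_ measurableT [set true] I); rewrite setTI.
Qed.

(* Tonelli: for 0 <= Z w, the set of y in [0, t] with Z w <= y has length
   (t - Z w) 1_{Z w <= t}. *)
Lemma expectation_past_life (d : measure_display) (T : measurableType d)
    (R : realType) (P : probability T R) (Z : T -> R) (t : R) :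
  measurable_fun [set: T] Z -> {ae P, forall w, 0 <= Z w} ->
  ('E_P[(fun w => (t - Z w) * \1_[set w | Z w <= t] w)%R] =
   \int[lebesgue_measure]_(x in `[0%R, t]) P [set w | (Z w <= x)%R])%E.
Proof.
move=> mZ Z_ge0.
pose mu := @lebesgue_measure R.
(* The region Z(w) <= y, 0 <= y <= t, whose indicator is integrated in both orders: its w-sections
   carry the lengths, its y-sections the events [Z <= y]. *)
pose A : set (T * measurableTypeR R) :=
  [set z | Z z.1 <= z.2] `&` [set z | `[0, t]%classic z.2].
have mA : measurable A.
  apply: measurableI.
  - have := measurable_fun_ler
      (measurableT_comp mZ (@measurable_fst _ _ T (measurableTypeR R)))
      measurable_snd.
    by move=> /(_ measurableT [set true] I); rewrite setTI.
  - rewrite -[X in measurable X]setTI.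
    exact: (@measurable_snd _ _ T (measurableTypeR R)).
have mZt : measurable [set w | Z w <= t] by exact: measurable_sublevel.
have := @indic_fubini_tonelli _ _ _ _ _ P mu A mA.
rewrite indic_fubini_tonelli_FE// indic_fubini_tonelli_GE// => FT.
transitivity (\int[P]_w (mu \o xsection A) w)%E.
  rewrite unlock; apply: ge0_ae_eq_integral => //.
  - apply/measurable_EFinP; apply: measurable_funM.
      exact: measurable_funB.
    exact: measurable_indic.
  - exact: measurable_fun_xsection.
  - move=> w _; rewrite lee_fin indicE.
    case: (boolP (w \in _)) => [|_]; last by rewrite mulr0.
    by rewrite inE/= mulr1 subr_ge0.
  (* Where Z(w) >= 0, the constraint 0 <= y follows from Z(w) <= y, so the section is exactly
     [Z(w), t]; elsewhere it could be shorter, hence only an almost-everywhere equality. *)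
  - apply: filterS Z_ge0 => w Zw _ /=.
    have -> : xsection A w = `[Z w, t]%classic.
      apply/seteqP; split=> y; rewrite /xsection/= inE /A/= !in_itv/=.
        by move=> [-> /andP[_ ->]].
      by move=> /andP[Zy ->]; rewrite Zy (le_trans Zw Zy).
    rewrite /mu lebesgue_measure_itv/= lte_fin indicE.
    have [Zt|tZ|Zt] := ltgtP (Z w) t.
    + by rewrite mem_set/= ?mulr1 ?EFinB// ltW.
    + by rewrite memNset/= ?mulr0//; apply/negP; rewrite -ltNge.
    + by rewrite Zt subrr mul0r.
(* In the other order y runs over the whole line; sections outside [0, t] are empty, which matches
   extending the right-hand integrand by 0. *)
rewrite FT [RHS]integral_mkcond; apply: eq_integral => y _ /=.
rewrite patchE; case: ifPn => [|]; rewrite ?inE ?notin_setE => yt.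
  congr (P _); apply/seteqP; split=> w; rewrite /ysection/= inE /A/=.
    by case.
  by [].
rewrite (_ : ysection A y = set0) ?measure0//.
by apply/seteqP; split=> w //; rewrite /ysection/= inE /A/= => -[].
Qed.

Lemma distribution_functionE (d : measure_display) (T : measurableType d)
    (R : realType) (P : probability T R) (X : {RV P >-> R}) (x : R) :
  P [set w | X w <= x] = (distribution_function X x)%:E.
Proof.
rewrite /distribution_function fineK; last exact: fin_num_measure.
by rewrite /cdf /distribution /pushforward set_itvE.
Qed.

(** The event X <= 0 splits into X < 0, null by hypothesis, and X = 0, whose probability is the
    integral of the density over a single point. *)
Lemma density_distribution_function0 (d : measure_display)
    (T : measurableType d) (R : realType) (P : probability T R)
    (X : {RV P >-> R}) (f : R -> R) :
  {ae P, forall w, 0 <= X w} -> has_density X f ->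
  distribution_function X 0 = 0.
Proof.
move=> X_ge0 [_ _ Xf]; apply: EFin_inj; rewrite -distribution_functionE.
have mX (A : set R) : measurable A -> measurable (X @^-1` A).
  by move=> mA; rewrite -[_ @^-1` _]setTI; exact: (measurable_funPT X).
have mX0 : measurable [set w | X w <= 0] by exact: measurable_sublevel.
apply/(negligibleP P mX0).
apply: (@negligibleS _ _ _ _ (~` [set w | 0 <= X w] `|` X @^-1` [set 0])).
  move=> w /=; rewrite le_eqVlt => /predU1P[|]; first by right.
  by move=> Xw; left; apply/negP; rewrite -ltNge.
apply: negligibleU => //.
apply/negligibleP; first exact: mX.
by have := Xf [set 0] (measurable_set1 _); rewrite integral_set1.
Qed.

Lemma probability_max_le (d : measure_display) (T : measurableType d)
    (R : realType) (P : probability T R) (X Y : {RV P >-> R}) (x : R) :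
  independent_RV2 X Y ->
  P [set w | Num.max (X w) (Y w) <= x] =
    (distribution_function X x * distribution_function Y x)%:E.
Proof.
move=> /(_ `]-oo, x] `]-oo, x])%classic.
move=> /(_ (measurable_itv _) (measurable_itv _)).
rewrite set_itvE EFinM -!distribution_functionE => <-.
by congr (P _); apply/seteqP; split=> w /=; rewrite ge_max => /andP.
Qed.

Theorem mainTheorem6 (R : realType)
  (d : measure_display) (T : measurableType d) (P : probability T R)
  (X : {RV P >-> R}) (f : R -> R)
  (d' : measure_display) (T' : measurableType d') (P' : probability T' R)
  (X1 X2 : {RV P' >-> R}) (t : R)
  (X_ge0 : {ae P, forall w, 0 <= X w})
  (X_density : has_density X f)
  (X_finite_mean : P.-integrable [set: T] (EFin \o X))
  (X12_indep : independent_RV2 X1 X2)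
  (X1_cdf : forall x, distribution_function X1 x = distribution_function X x)
  (X2_cdf : forall x, distribution_function X2 x = distribution_function X x)
  (t_gt0 : 0 < t)
  (Ft_gt0 : 0 < distribution_function X t) :
  (dynamic_cumulative_extropy X t)%:E =
    ((- (1 / 2))%:E *
     cond_expectation P' (fun w => t - Num.max (X1 w) (X2 w))%R
       [set w | Num.max (X1 w) (X2 w) <= t]%R)%E
  /\
  (- 2 * dynamic_cumulative_extropy X t)%:E =
    mean_past_life P' (parallel_lifetime X1 X2) t.
Proof.
set M := fun w => Num.max (X1 w) (X2 w).
pose F := distribution_function X.
have PM x : P' [set w | M w <= x] = (F x ^+ 2)%:E.
  by rewrite probability_max_le// X1_cdf X2_cdf.
have mM : measurable_fun [set: T'] M by exact: measurable_maxr.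
have mMle x : measurable [set w | M w <= x] by exact: measurable_sublevel.
(* The set where M < 0 lies in the event M <= 0, of probability F(0)^2 = 0. *)
have M_ge0 : {ae P', forall w, 0 <= M w}.
  have M_le0 : P'.-negligible [set w | M w <= 0].
    by apply/negligibleP => //; rewrite [LHS]PM /F (density_distribution_function0 _ _ _ _ _ _ X_ge0 X_density)// expr0n.
  apply: negligibleS M_le0 => w /= /negP.
  by rewrite -ltNge => /ltW.
have E_M : ('E_P'[(fun w => (t - M w) * \1_[set w | M w <= t] w)%R] =
    (\int[lebesgue_measure]_(x in `[0%R, t]) (F x ^+ 2))%R%:E)%E.
  rewrite expectation_past_life//; under eq_integral do rewrite PM.
  (* The real-valued integral is [fine] of the extended one, so finiteness has to be proved: F^2 is
     a probability, hence at most 1, and the integral is at most t. *)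
  rewrite /Rintegral fineK// ge0_fin_numE; last first.
    by apply: integral_ge0 => x _; rewrite lee_fin sqr_ge0.
  apply: (@le_lt_trans _ _
      (\int[lebesgue_measure]_(x in `[0%R, t]) cst 1 x)%E); last first.
    rewrite integral_cst//= lebesgue_measure_itv/= lte_fin t_gt0.
    by rewrite mul1e -EFinB ltry.
  apply: ge0_le_integral => //= [x _||x _].
  - by rewrite lee_fin sqr_ge0.
  - apply/measurable_EFinP; apply: measurable_funX.
    apply: (measurable_funS measurableT) => //.
    exact: (measurableT_comp _ (cdf_measurable X)).
  - by rewrite -PM probability_le1.
(* Both conjuncts reduce to this identity: each side is the integral of F^2 over [0, t] divided by
   F(t)^2, which is nonzero by [Ft_gt0]. *)
have cE : cond_expectation P' (fun w => t - M w) [set w | M w <= t] =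
    (- 2 * dynamic_cumulative_extropy X t)%:E.
  rewrite /cond_expectation [X in (X * _)%E]E_M PM -EFinM.
  congr EFin; rewrite /dynamic_cumulative_extropy -/F /=.
  set I := Rintegral _ _ _.
  have : F t != 0 by rewrite gt_eqF.
  by move: I (F t) => I a a_neq0; field.
rewrite /mean_past_life [cond_expectation _ _ _]cE -EFinM.
by split=> //; congr EFin; field.
Qed.
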